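(* Let $u,v:\Omega_\varepsilon\to\mathbb{R}$ be bounded Borel functions with boundary values $g:=u|_{\Gamma_\varepsilon}$ and $h:=v|_{\Gamma_\varepsilon}$, satisfying $$T_g u=u,\qquad T_h v=v\qquad\text{in }\Omega_\varepsilon.$$ Then $$\sup_{x\in\Omega}(u-v)(x)\le\sup_{x\in\Gamma_\varepsilon}(g-h)(x).$$ In particular, for every bounded Borel $F:\Gamma_\varepsilon\to\mathbb{R}$ there is at most one bounded Borel function $v_\varepsilon:\Omega_\varepsilon\to\mathbb{R}$ with $v_\varepsilon=F$ on $\Gamma_\varepsilon$ and $T_Fv_\varepsilon=v_\varepsilon$ in $\Omega_\varepsilon$.
   Context: $n\ge1$, $\Omega\subset\mathbb{R}^n$ is a bounded domain, $\varepsilon>0$, $p\ge 2$ is fixed, and $\widetilde\alpha=\frac{p-2}{p+n+1}$, $\widetilde\beta=\frac{n+3}{p+n+1}$ (so $\widetilde\alpha+\widetilde\beta=1$). $\Gamma_\varepsilon=\{x\in\mathbb{R}^n\setminus\Omega:\operatorname{dist}(x,\Omega)\le\varepsilon\}$, $\Omega_\varepsilon=\Omega\cup\Gamma_\varepsilon$. $B_\varepsilon(0)\subset\mathbb{R}^n$ is the open ball of radius $\varepsilon$ at $0$, and $\rho_\varepsilon(h)=2\sqrt{\varepsilon^2-|h|^2}/|B_\varepsilon^{n+1}|$ for $h\in B_\varepsilon(0)$, where $|B_\varepsilon^{n+1}|$ is the Lebesgue measure of a ball of radius $\varepsilon$ in $\mathbb{R}^{n+1}$. For $u:\Omega_\varepsilon\to\mathbb{R}$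 bounded and $x\in\Omega$, $$S^+[u](x)=\sup_{\tilde x\in\Omega_\varepsilon,\ |\tilde x-x|\le\varepsilon}\Bigl(u(\tilde x)+\sqrt{\varepsilon^2-|\tilde x-x|^2}\Bigr),\quad S^-[u](x)=\inf_{\tilde x\in\Omega_\varepsilon,\ |\tilde x-x|\le\varepsilon}\Bigl(u(\tilde x)-\sqrt{\varepsilon^2-|\tilde x-x|^2}\Bigr).$$ For bounded Borel $F:\Gamma_\varepsilon\to\mathbb{R}$ and bounded Borel $u:\Omega_\varepsilon\to\mathbb{R}$ with $u|_{\Gamma_\varepsilon}=F$, define $T_Fu(x)=F(x)$ for $x\in\Gamma_\varepsilon$ and $$T_Fu(x)=\frac{\widetilde\alpha}{2}\bigl(S^+[u](x)+S^-[u](x)\bigr)+\widetilde\beta\int_{B_\varepsilon(0)}u(x+y)\rho_\varepsilon(y)\,dy,\qquad x\in\Omega.$$ *)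

(* Defs.v *)
From HB Require Import structures.
From mathcomp Require Import all_boot all_order all_algebra.
From mathcomp Require Import all_classical all_reals all_analysis.
From mathcomp Require Import measurable_realfun.

Set Implicit Arguments.
Unset Strict Implicit.
Unset Printing Implicit Defensive.

Import Order.TTheory GRing.Theory Num.Theory.
Import numFieldNormedType.Exports.

Local Open Scope classical_set_scope.
Local Open Scope ring_scope.

(* Row vectors carry the Borel sigma-algebra of their (product) topology. *)
HB.instance Definition _ (R : realType) (n : nat) :=
  @isMeasurable.Build (sigma_display (@open 'rV[R]_n)) 'rV[R]_n
    <<s @open 'rV[R]_n >> (@sigma_algebra0 _ setT _)
    (@sigma_algebraC _ _) (@sigma_algebra_bigcup _ setT _).

Section borel_row.
Context {R : realType}.

Lemma measurable_coord n (i : 'I_n) :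
  measurable_fun [set: 'rV[R]_n] (fun x : 'rV[R]_n => x ord0 i).
Proof.
apply: (measurability _ (RGenOpens.measurableE R)).
move=> _ [_ [a [b ->] <-]]; rewrite setTI; apply: sub_sigma_algebra.
have /continuousP := @coord_continuous R 1 n ord0 i.
by apply; exact: interval_open.
Qed.

Lemma measurable_rowP d (T : measurableType d) n (f : T -> 'rV[R]_n) :
  (forall i, measurable_fun [set: T] (fun t => f t ord0 i)) ->
  measurable_fun [set: T] f.
Proof.
move=> mf.
apply: (@measurability _ _ _ _ setT f (@open 'rV[R]_n) (erefl _)).
move=> _ [U oU <-]; rewrite setTI.
pose B (qk : 'rV[rat]_n * nat) : set 'rV[R]_n := [set y | forall i,
  ball (ratr (qk.1 ord0 i) : R) (qk.2.+1%:R^-1) (y ord0 i)].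
rewrite (_ : f @^-1` U = \bigcup_qk
    (if `[< B qk `<=` U >] then f @^-1` B qk else set0)); last first.
  apply/seteqP; split => t /=; last first.
    by move=> [qk _]; case: ifPn => // /asboolP; apply.
  move=> Uft; have /nbhs_ballP[e /= e0 eU] := open_nbhs_nbhs (conj oU Uft).
  have [k ke] : exists k : nat, k.+1%:R^-1 < e / 2.
    have e20 : 0 < e / 2 by rewrite divr_gt0.
    by have [k _ /(_ _ (leqnn k)) ?] := near_infty_natSinv_lt (PosNum e20);
      exists k.
  have /choice[q fq] : forall i : 'I_n, exists q : rat,
      ball (ratr q : R) k.+1%:R^-1 (f t ord0 i).
    move=> i; have k0 : 0 < k.+1%:R^-1 :> R by rewrite invr_gt0.
    have [||r [/= br [q _ qr]]] := @dense_rat R (ball (f t ord0 i) k.+1%:R^-1).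
    - by exists (f t ord0 i); exact: ballxx.
    - exact: ball_open.
    - by exists q; rewrite qr; exact: ball_sym.
  exists (\row_i q i, k) => //; case: ifPn => [_ i|/asboolP[]].
    by rewrite /= mxE.
  move=> y By; apply: eU; split => // i j.
  rewrite ord1; have := By j; rewrite /= mxE => yq.
  apply: (le_ball (ltW _)); last exact: (ball_triangle (ball_sym (fq j)) yq).
  by rewrite [e]splitr ltrD.
apply: countable_bigcupT_measurable => // qk; case: ifPn => // _.
rewrite (_ : f @^-1` _ = \bigcap_(i in [set: 'I_n])
   ((fun t => f t ord0 i) @^-1` ball (ratr (qk.1 ord0 i) : R) qk.2.+1%:R^-1)).
  apply: fin_bigcap_measurable => // i _; rewrite -[X in measurable X]setTI.
  by apply: mf => //; apply: open_measurable; exact: ball_open.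
by apply/seteqP; split => [t Bt i _|t Bt i]; exact: Bt.
Qed.

Definition row_cons n (ty : R * 'rV[R]_n) : 'rV[R]_n.+1 :=
  \row_i (if unlift ord0 i is Some j then ty.2 ord0 j else ty.1).

Definition row_uncons n (x : 'rV[R]_n.+1) : R * 'rV[R]_n :=
  (x ord0 ord0, \row_j x ord0 (lift ord0 j)).

Lemma row_cons0 n (ty : R * 'rV[R]_n) : row_cons ty ord0 ord0 = ty.1.
Proof. by rewrite mxE unlift_none. Qed.

Lemma row_consS n (ty : R * 'rV[R]_n) j :
  row_cons ty ord0 (lift ord0 j) = ty.2 ord0 j.
Proof. by rewrite mxE liftK. Qed.

Lemma row_consK n : cancel (@row_cons n) (@row_uncons n).
Proof.
move=> [t y]; congr (_, _); first exact: row_cons0.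
by apply/rowP => j; rewrite mxE row_consS.
Qed.

Lemma measurable_row_cons n : measurable_fun setT (@row_cons n).
Proof.
apply: measurable_rowP => i; case: (unliftP ord0 i) => [j|] ->.
  under [X in measurable_fun _ X]funext do rewrite row_consS.
  apply: (measurableT_comp (measurable_coord j)); exact: measurable_snd.
under [X in measurable_fun _ X]funext do rewrite row_cons0.
exact: measurable_fst.
Qed.

Lemma measurable_row_uncons n : measurable_fun setT (@row_uncons n).
Proof.
apply: measurable_fun_pair; first exact: measurable_coord.
apply: measurable_rowP => i.
under [X in measurable_fun _ X]funext do rewrite mxE.
exact: measurable_coord.
Qed.

End borel_row.

Section lebesgue_succ.
Local Open Scope ereal_scope.
Context {R : realType} (n : nat).
Variable m : {sigma_finite_measure set 'rV[R]_n -> \bar R}.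

Definition lebesgue_succ : set 'rV[R]_n.+1 -> \bar R :=
  pushforward ((@lebesgue_measure R) \x m) (@row_cons R n).

Let M : {measure set 'rV[R]_n.+1 -> \bar R} :=
  measure_function_pushforward__canonical__measure_function_Measure
    ((@lebesgue_measure R) \x m) (@measurable_row_cons R n).

Let lebesgue_succ0 : lebesgue_succ set0 = 0.
Proof. exact: (measure0 M). Qed.

Let lebesgue_succ_ge0 A : 0 <= lebesgue_succ A.
Proof. exact: (measure_ge0 M). Qed.

Let lebesgue_succ_sigma_additive : semi_sigma_additive lebesgue_succ.
Proof. exact: (@measure_semi_sigma_additive _ _ _ M). Qed.

HB.instance Definition _ := isMeasure.Build _ _ _ lebesgue_succ
  lebesgue_succ0 lebesgue_succ_ge0 lebesgue_succ_sigma_additive.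

Let lebesgue_succ_sigma_finite : sigma_finite setT lebesgue_succ.
Proof.
have /sigma_finiteP[F [FT ndF Foo]] := sigma_finiteT (@lebesgue_measure R).
have /sigma_finiteP[G [GT ndG Goo]] := sigma_finiteT m.
exists (fun k => @row_uncons R n @^-1` (F k `*` G k)).
  rewrite -preimage_bigcup -[LHS](@preimage_setT _ _ (@row_uncons R n)).
  congr (_ @^-1` _); rewrite -setXTT FT GT.
  apply/seteqP; split => -[t y] /= => [[[k _ Ft] [l _ Gy]]|[k _ [/= Ft Gy]]].
    exists (maxn k l) => //; split.
      by move: Ft; exact/subsetPset/ndF/leq_maxl.
    by move: Gy; exact/subsetPset/ndG/leq_maxr.
  by split; exists k.
move=> k; have [mF Ffin] := Foo k; have [mG Gfin] := Goo k; split.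
  rewrite -[X in measurable X]setTI.
  by apply: measurable_row_uncons => //; exact: measurableX.
rewrite /lebesgue_succ /pushforward -comp_preimage.
rewrite (_ : _ \o _ = id) ?preimage_id; last exact/funext/row_consK.
by rewrite product_measure1E// lte_mul_pinfty// ge0_fin_numE.
Qed.

HB.instance Definition _ := Measure_isSigmaFinite.Build _ _ _ lebesgue_succ
  lebesgue_succ_sigma_finite.

End lebesgue_succ.

Section lebesgue_row.
Local Open Scope ereal_scope.
Context {R : realType}.

(* Lebesgue measure on R^n as an iterated product of the Lebesgue measure on R;
   [lebesgue_row_box] gives its value on products of Borel sets. *)
Fixpoint lebesgue_row n : {sigma_finite_measure set 'rV[R]_n -> \bar R} :=
  match n with
  | 0 => \d_(0%R : 'rV[R]_0)
  | n'.+1 => lebesgue_succ (lebesgue_row n')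
  end.

Lemma lebesgue_row_box n (A : 'I_n -> set R) : (forall i, measurable (A i)) ->
  lebesgue_row n [set x : 'rV[R]_n | forall i, A i (x ord0 i)] =
  \prod_(i < n) lebesgue_measure (A i).
Proof.
elim: n A => [|n IHn] A mA.
  by rewrite big_ord0 /= diracE mem_set//= => -[].
rewrite big_ord_recl -IHn => [|i]; last exact: mA.
rewrite -product_measure1E//=; first last; [|exact: mA|].
  rewrite (_ : mkset _ = \bigcap_(i in [set: 'I_n])
     ((fun x : 'rV[R]_n => x ord0 i) @^-1` A (lift ord0 i))).
    apply: fin_bigcap_measurable => // i _; rewrite -[X in measurable X]setTI.
    exact: measurable_coord.
  by apply/seteqP; split => [x Ax i _|x Ax i]; exact: Ax.
rewrite /lebesgue_succ /pushforward; congr ((_ \x _) _).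
apply/seteqP; split => -[t y] /=.
  move=> Aty; split; first by have := Aty ord0; rewrite row_cons0.
  by move=> i; have := Aty (lift ord0 i); rewrite row_consS.
move=> [At Ay] i; case: (unliftP ord0 i) => [j|] ->.
  by rewrite row_consS; exact: Ay.
by rewrite row_cons0.
Qed.

End lebesgue_row.

Section tug_of_war.
Context {R : realType}.

(* The norm that the library puts on row vectors is the sup norm. *)
Definition enorm n (x : 'rV[R]_n) : R :=
  Num.sqrt (\sum_(i < n) x ord0 i ^+ 2).

Definition eball n (eps : R) : set 'rV[R]_n := [set y | enorm y < eps].
Arguments eball : clear implicits.

Context {n : nat}.
Implicit Types (Omega : set 'rV[R]_n) (u F : 'rV[R]_n -> R) (x h : 'rV[R]_n).
Implicit Types eps p : R.

Definition domain Omega := [/\ Omega !=set0, open Omega & connected Omega].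

Definition set_dist x Omega : R := inf [set enorm (x - y) | y in Omega].

Definition outer_strip Omega eps : set 'rV[R]_n :=
  [set x | ~ Omega x /\ set_dist x Omega <= eps].

Definition extended_domain Omega eps : set 'rV[R]_n :=
  Omega `|` outer_strip Omega eps.

(* A function on a subset [A] is represented by a total function, whose values
   outside [A] are irrelevant. *)
Definition bounded_borel (A : set 'rV[R]_n) u :=
  [bounded u x | x in A] /\ measurable_fun A u.

Definition reach Omega eps x : set 'rV[R]_n :=
  [set z | extended_domain Omega eps z /\ enorm (z - x) <= eps].

Definition Splus Omega eps u x : R :=
  sup [set u z + Num.sqrt (eps ^+ 2 - enorm (z - x) ^+ 2)
      | z in reach Omega eps x].

Definition Sminus Omega eps u x : R :=
  inf [set u z - Num.sqrt (eps ^+ 2 - enorm (z - x) ^+ 2)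
      | z in reach Omega eps x].

Definition rho eps h : R :=
  2 * Num.sqrt (eps ^+ 2 - enorm h ^+ 2) /
  fine (lebesgue_row n.+1 (eball n.+1 eps)).

Definition alpha_tilde p : R := (p - 2) / (p + n%:R + 1).

Definition beta_tilde p : R := (n%:R + 3) / (p + n%:R + 1).

Definition T_op Omega eps p F u x : R :=
  if x \in outer_strip Omega eps then F x else
  alpha_tilde p / 2 * (Splus Omega eps u x + Sminus Omega eps u x) +
  beta_tilde p *
    \int[lebesgue_row n]_(y in eball n eps) (u (x + y) * rho eps y).

End tug_of_war.
Arguments eball {R} n eps.
Arguments alpha_tilde {R} n p.
Arguments beta_tilde {R} n p.

(* Main.v *)
(* Put w = u - v and M = sup_Omega w, and suppose that M > sup_Gamma w. Both S^+
   and S^- are monotone and commute with adding constants, and rho has mass one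
   (Fubini: it is the chord length of the (n+1)-ball divided by its volume), so
   the fixed-point equations at x in Omega give
     beta * avg_y (M - w (x + y)) <= M - w x,
   the average being taken with respect to rho. Hence if w x > M - beta kappa a,
   the deficit M - w (x + y) is below a for some y in a fixed cube of positive
   measure inside the ball, all of whose points have coordinates at least d > 0.
   For a <= M - sup_Gamma w this forces x + y to lie in Omega. Starting close
   enough to M this can be repeated any number of times, and the first coordinate
   grows by at least d each time, contradicting the boundedness of Omega. *)

Require Import Defs.
From mathcomp Require Import all_boot all_order all_algebra.
From mathcomp Require Import all_classical all_reals all_analysis.
From mathcomp Require Import measurable_realfun.
From mathcomp Require Import ring lra.

Set Implicit Arguments.
Unset Strict Implicit.
Unset Printing Implicit Defensive.

Import Order.TTheory GRing.Theory Num.Theory.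
Import numFieldNormedType.Exports.

Local Open Scope classical_set_scope.
Local Open Scope ring_scope.

(** * Euclidean norm, distance to the domain, and Borel measurability *)

Section euclidean_norm.
Context {R : realType} {n : nat}.
Implicit Types (x y : 'rV[R]_n) (Omega : set 'rV[R]_n) (eps : R).

Lemma enorm_ge0 x : 0 <= enorm x.
Proof. exact: sqrtr_ge0. Qed.

Lemma enorm_sqr x : enorm x ^+ 2 = \sum_(i < n) x ord0 i ^+ 2.
Proof. by rewrite sqr_sqrtr// sumr_ge0// => i _; exact: sqr_ge0. Qed.

Lemma enorm0 : enorm (0 : 'rV[R]_n) = 0.
Proof.
by rewrite /enorm big1 ?sqrtr0// => i _; rewrite mxE expr0n.
Qed.

Lemma enorm_opp x : enorm (- x) = enorm x.
Proof. by congr Num.sqrt; apply: eq_bigr => i _; rewrite mxE sqrrN. Qed.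

Lemma normr_coord_le_enorm x i : `|x ord0 i| <= enorm x.
Proof.
rewrite -sqrtr_sqr ler_wsqrtr// (bigD1 i)//= lerDl.
by apply: sumr_ge0 => j _; exact: sqr_ge0.
Qed.

Lemma enorm_sqr_le x (d : R) : (forall i, `|x ord0 i| <= d) ->
  enorm x ^+ 2 <= n%:R * d ^+ 2.
Proof.
move=> xd; rewrite enorm_sqr; apply: (@le_trans _ _ (\sum_(i < n) d ^+ 2)).
  apply: ler_sum => i _; rewrite -real_normK ?num_real//.
  by rewrite lerXn2r ?nnegrE// (le_trans _ (xd i)).
by rewrite sumr_const card_ord mulr_natl.
Qed.

Lemma continuous_enorm : continuous (@enorm R n).
Proof.
have cs : continuous (fun x : 'rV[R]_n => \sum_(i < n) x ord0 i ^+ 2).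
  apply: continuous_big => [|i _]; first exact: add_continuous.
  move=> x; apply: (@continuous_comp _ _ _ (fun x : 'rV[R]_n => x ord0 i)
    (fun t : R => t ^+ 2)).
    exact: coord_continuous.
  exact: exprn_continuous.
by move=> x; apply: continuous_comp (cs x) _; exact: sqrt_continuous.
Qed.

Lemma open_enorm_lt x (r : R) : open [set y | enorm (x - y) < r].
Proof.
have /continuousP : continuous (fun y => enorm (x - y)).
  move=> y; apply: (@continuous_comp _ _ _ (fun y : 'rV[R]_n => x - y) (@enorm R n)).
    by apply: continuousB; [exact: cst_continuous|exact: cvg_id].
  exact: continuous_enorm.
by move=> /(_ _ (@open_lt R r)).
Qed.

Lemma open_measurable_row (U : set 'rV[R]_n) : open U -> measurable U.
Proof. exact: sub_sigma_algebra. Qed.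

Lemma continuous_measurable_row (f : 'rV[R]_n -> R) :
  continuous f -> measurable_fun setT f.
Proof.
move=> /continuousP cf; apply: (measurability _ (RGenOpens.measurableE R)).
move=> _ [_ [a [b ->] <-]]; rewrite setTI; apply: open_measurable_row.
by apply: cf; exact: interval_open.
Qed.

Lemma measurable_eball eps : measurable (@eball R n eps).
Proof.
apply: open_measurable_row; rewrite (_ : eball n eps = [set y | enorm (0 - y) < eps]).
  exact: open_enorm_lt.
by apply/funext => y /=; rewrite sub0r enorm_opp.
Qed.

(** Nonemptiness excludes the default value [inf set0 = 0], for which there would be no witness. *)
Lemma set_dist_lt x Omega eps : Omega !=set0 -> set_dist x Omega < eps ->
  exists2 y, Omega y & enorm (x - y) < eps.
Proof.
move=> [y0 Oy0] /inf_lt[|_ [y Oy <-] ?]; last by exists y.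
by exists (enorm (x - y0)), y0.
Qed.

Lemma set_dist_le x y Omega : Omega y -> set_dist x Omega <= enorm (x - y).
Proof.
move=> Oy; apply: ge_inf; last by exists y.
by exists 0 => _ [z _ <-]; exact: enorm_ge0.
Qed.

(** Points of [Omega] are at distance 0 from it, so the union collapses to a single sublevel set of
    the distance. *)
Lemma extended_domainE Omega eps : 0 < eps ->
  extended_domain Omega eps = [set x | set_dist x Omega <= eps].
Proof.
move=> e0; apply/seteqP; split => x /=.
  case=> [Ox|[]//]; apply: (le_trans (set_dist_le x Ox)).
  by rewrite subrr enorm0 ltW.
by have [Ox|nOx] := pselect (Omega x); [left|right].
Qed.

Lemma extended_domain_near Omega eps x y : 0 < eps -> Omega x ->
  enorm y <= eps -> extended_domain Omega eps (x + y).
Proof.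
move=> e0 Ox ye; rewrite extended_domainE//=; apply: (le_trans (set_dist_le _ Ox)).
by rewrite addrC addKr.
Qed.

(** The closed neighbourhood is a countable intersection of neighbourhoods of radius
    [eps + 1/(k+1)], each open as a union of open Euclidean balls. *)
Lemma measurable_extended_domain Omega eps : 0 < eps -> Omega !=set0 ->
  measurable (extended_domain Omega eps).
Proof.
move=> e0 O0; rewrite extended_domainE// (_ : mkset _ =
    \bigcap_(k : nat) \bigcup_(y in Omega) [set x | enorm (x - y) < eps + k.+1%:R^-1]).
  apply: bigcap_measurable => // k _; apply: open_measurable_row.
  apply: bigcup_open => y _; rewrite (_ : mkset _ =
    [set x | enorm (y - x) < eps + k.+1%:R^-1]); first exact: open_enorm_lt.
  by apply/funext => x /=; rewrite -enorm_opp opprB.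
apply/seteqP; split => x /= => [xe k _|xe].
  have [|y Oy ?] := @set_dist_lt x Omega (eps + k.+1%:R^-1) O0; last by exists y.
  by rewrite (le_lt_trans xe)// ltrDl.
apply/ler_addgt0Pr => d d0.
have [k _ /(_ _ (leqnn k)) kd] := near_infty_natSinv_lt (PosNum d0).
have [y Oy yk] := xe k I; apply: (le_trans (set_dist_le _ Oy)).
by rewrite (le_trans (ltW yk))// lerD2l ltW.
Qed.

Lemma measurable_translation x : measurable_fun setT (fun y => x + y).
Proof.
apply: measurable_rowP => i.
under [X in measurable_fun _ X]funext do rewrite mxE.
by apply: measurable_funD => //; exact: measurable_coord.
Qed.

End euclidean_norm.

(** * Volumes of Euclidean balls, and a cube inside the ball *)

Section ball_measure.
Context {R : realType}.

(** Chosen so that coordinates up to [2 * side n eps = eps / (n+1)] keep the Euclidean norm below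
    [eps]. *)
Definition side (n : nat) (eps : R) : R := eps / (2 * n.+1%:R).

(** The cube avoids the origin: translating by any of its points raises every coordinate by at least
    [d]. *)
Definition corner_box n (d : R) : set 'rV[R]_n :=
  [set y | forall i, `[d, 2 * d]%classic (y ord0 i)].

Lemma side_gt0 n (eps : R) : 0 < eps -> 0 < side n eps.
Proof. by move=> e0; rewrite /side divr_gt0// mulr_gt0. Qed.

Lemma measurable_corner_box n d : measurable (@corner_box n d).
Proof.
rewrite (_ : corner_box _ = \bigcap_(i in [set: 'I_n])
   ((fun x : 'rV[R]_n => x ord0 i) @^-1` `[d, 2 * d]%classic)).
  apply: fin_bigcap_measurable => // i _; rewrite -[X in measurable X]setTI.
  exact: measurable_coord.
by apply/seteqP; split => [x Ax i _|x Ax i]; exact: Ax.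
Qed.

Lemma corner_box_measure n d : 0 < d ->
  lebesgue_row n (@corner_box n d) = (d ^+ n)%:E.
Proof.
move=> d0; rewrite (lebesgue_row_box (fun=> measurable_itv `[d, 2 * d])).
rewrite -[in RHS](card_ord n) -prodr_const -prodEFin.
apply: eq_big => [i|i _]; first by rewrite inE.
rewrite lebesgue_measure_itv/= lte_fin ifT.
  by rewrite -EFinB; congr EFin; lra.
lra.
Qed.

(** The bound is uniform on the cube and, by the next lemma, strictly below [eps ^+ 2]; hence [rho]
    is bounded away from 0 there. *)
Lemma corner_box_enorm n (eps : R) (y : 'rV[R]_n) :
  0 < eps -> corner_box (side n eps) y ->
  enorm y ^+ 2 <= n%:R * (eps / n.+1%:R) ^+ 2.
Proof.
move=> e0 By; apply: enorm_sqr_le => i; have := By i; rewrite /= in_itv/= => /andP[yl yu].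
have d0 := @side_gt0 n _ e0.
rewrite ger0_norm; last by apply: le_trans yl; exact: ltW.
by rewrite (le_trans yu)// /side invfM mulrCA mulVKf.
Qed.

Lemma corner_box_bound n (eps : R) : 0 < eps ->
  n%:R * (eps / n.+1%:R) ^+ 2 < eps ^+ 2.
Proof.
move=> e0; rewrite expr_div_n mulrCA gtr_pMr ?exprn_gt0//.
rewrite ltr_pdivrMr ?exprn_gt0// mul1r -natrX ltr_nat.
by rewrite (leq_trans (ltnSn n))// -mulnn leq_pmulr.
Qed.

Lemma corner_box_sub_eball n (eps : R) : 0 < eps ->
  corner_box (side n eps) `<=` eball n eps.
Proof.
move=> e0 y By; rewrite /eball/=.
rewrite -(@ltr_pXn2r _ 2) ?nnegrE ?enorm_ge0 ?ltW//.
exact: le_lt_trans (corner_box_enorm e0 By) (corner_box_bound _ e0).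
Qed.

(** With the finiteness below, this makes the denominator of [rho] a genuine positive volume rather
    than a default value of [fine]. *)
Lemma eball_measure_gt0 n (eps : R) : 0 < eps ->
  (0 < lebesgue_row n (eball n eps))%E.
Proof.
move=> e0; have d0 := @side_gt0 n _ e0.
apply: (@lt_le_trans _ _ (lebesgue_row n (@corner_box n (side n eps)))).
  by rewrite corner_box_measure// lte_fin exprn_gt0.
apply: le_measure; rewrite ?inE.
- exact: measurable_corner_box.
- exact: measurable_eball.
- exact: corner_box_sub_eball.
Qed.

Lemma eball_measure_fin n (eps : R) : (lebesgue_row n (eball n eps) < +oo)%E.
Proof.
pose B := [set y : 'rV[R]_n | forall i, `[- eps, eps]%classic (y ord0 i)].
have mB : measurable B.
  rewrite (_ : B = \bigcap_(i in [set: 'I_n])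
     ((fun x : 'rV[R]_n => x ord0 i) @^-1` `[- eps, eps]%classic)).
    apply: fin_bigcap_measurable => // i _; rewrite -[X in measurable X]setTI.
    exact: measurable_coord.
  by apply/seteqP; split => [x Ax i _|x Ax i]; exact: Ax.
apply: (@le_lt_trans _ _ (lebesgue_row n B)).
  apply: le_measure; rewrite ?inE//; first exact: measurable_eball.
  move=> y /= ye i; rewrite /= in_itv/= -ler_norml.
  by rewrite (le_trans (normr_coord_le_enorm _ _))// ltW.
rewrite (lebesgue_row_box (fun=> measurable_itv `[- eps, eps])).
rewrite (eq_bigr (fun=> (fine (lebesgue_measure `[- eps, eps]%classic))%:E)).
  by rewrite prodEFin ltry.
move=> i _; rewrite fineK// lebesgue_measure_itv/=; by case: ifPn.
Qed.

Lemma enorm_row_cons n (t : R) (y : 'rV[R]_n) :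
  enorm (row_cons (t, y)) ^+ 2 = t ^+ 2 + enorm y ^+ 2.
Proof.
rewrite !enorm_sqr big_ord_recl row_cons0; congr (_ + _).
by apply: eq_bigr => i _; rewrite row_consS.
Qed.

(** For [r <= 0] both sides are false, since [Num.sqrt r] is then 0. *)
Lemma normr_lt_sqrt (t r : R) : (`|t| < Num.sqrt r) = (t ^+ 2 < r).
Proof.
have [r0|r0] := ltP 0 r; first by rewrite -sqrtr_sqr ltr_sqrt.
rewrite ler0_sqrtr// ltNge normr_ge0/=; apply/esym/negbTE.
by rewrite -leNgt (le_trans r0)// sqr_ge0.
Qed.

(** Fubini: the slice of the ball above [y] is an open interval of half-length
    [Num.sqrt (eps ^+ 2 - enorm y ^+ 2)]. *)
Lemma eball_succ_measure n (eps : R) : 0 < eps ->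
  lebesgue_row n.+1 (eball n.+1 eps) =
  (\int[lebesgue_row n]_(y in eball n eps)
     (2 * Num.sqrt (eps ^+ 2 - enorm y ^+ 2))%:E)%E.
Proof.
move=> e0; have mS : measurable (@row_cons R n @^-1` eball n.+1 eps).
  rewrite -[X in measurable X]setTI.
  by apply: measurable_row_cons => //; exact: measurable_eball.
(* The measure is built by slicing at fixed first coordinate; uniqueness of the product measure
   allows slicing at fixed [y] instead. *)
rewrite /= /lebesgue_succ /pushforward (@product_measure_unique _ _ _ _ _ _ _
  ((@lebesgue_measure R) \x^ (lebesgue_row n))%E) //; last first.
  move=> A B mA mB; exact: product_measure2E.
rewrite /product_measure2/= [RHS]integral_mkcond; apply: eq_integral => y _.
rewrite /= patchE; set r := eps ^+ 2 - enorm y ^+ 2.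
rewrite (_ : ysection _ y = `]- Num.sqrt r, Num.sqrt r[%classic); last first.
  apply/funext => t; rewrite ysectionE /= in_itv/= -ltr_norml; apply/propext.
  rewrite /eball/=; rewrite -(@ltr_pXn2r _ 2) ?nnegrE ?enorm_ge0 ?ltW// enorm_row_cons.
  by rewrite normr_lt_sqrt ltrBrDr.
rewrite lebesgue_measure_itv/= lte_fin; case: (boolP (y \in _)) => [|yE].
  rewrite inE /eball/= => ye; have r0 : 0 < r.
    by rewrite subr_gt0 ltr_pXn2r ?nnegrE ?enorm_ge0 ?ltW.
  by rewrite gtrN ?sqrtr_gt0// -EFinB; congr EFin; ring.
(* Outside the ball the root is 0 and the slice is empty. *)
rewrite ler0_sqrtr ?oppr0 ?ltxx// subr_le0 ler_pXn2r ?nnegrE ?enorm_ge0 ?(ltW e0)//.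
by rewrite leNgt; apply: contra yE => ye; rewrite inE.
Qed.
End ball_measure.

(** * Averages with respect to the density [rho] *)

Section averaging.
Context {R : realType} {n : nat}.
Implicit Types (y : 'rV[R]_n) (f : 'rV[R]_n -> R) (eps : R).

Lemma measurable_half_chord eps D :
  measurable_fun D (fun y => Num.sqrt (eps ^+ 2 - enorm y ^+ 2)).
Proof.
have ms : measurable_fun setT (@Num.sqrt R).
  by apply: continuous_measurable_fun; exact: sqrt_continuous.
have mb : measurable_fun setT (fun y => eps ^+ 2 - enorm y ^+ 2).
  apply: measurable_funB => //; apply: measurable_funX.
  by apply: continuous_measurable_row; exact: continuous_enorm.
exact: measurable_funTS (measurableT_comp ms mb).
Qed.

Lemma measurable_rho eps D : measurable_fun D (@rho R n eps).
Proof.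
by apply: measurable_funM => //; apply: measurable_funM => //;
  exact: measurable_half_chord.
Qed.

Lemma rho_ge0 eps y : 0 <= rho eps y.
Proof. by rewrite /rho divr_ge0 ?mulr_ge0 ?sqrtr_ge0// fine_ge0. Qed.

Lemma integral_rho eps : 0 < eps ->
  (\int[lebesgue_row n]_(y in eball n eps) (rho eps y)%:E = 1)%E.
Proof.
move=> e0; have m0 := @eball_measure_gt0 R n.+1 _ e0.
have moo := @eball_measure_fin R n.+1 eps.
have mf : lebesgue_row n.+1 (eball n.+1 eps) \is a fin_num by rewrite gt0_fin_numE.
rewrite /rho; set c := fine _.
have c0 : 0 < c by rewrite fine_gt0// m0.
under eq_integral do rewrite mulrC EFinM.
rewrite ge0_integralZl//; last by rewrite lee_fin invr_ge0 ltW.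
- by rewrite -eball_succ_measure// -[X in (_ * X)%E]fineK// -EFinM mulVf ?gt_eqF//.
- exact: measurable_eball.
- apply/measurable_EFinP; apply: measurable_funM => //.
  exact: measurable_half_chord.
Qed.

(** The product is dominated by [C] times [rho], which has integral [C]. *)
Lemma integrable_mul_rho eps f (C : R) : 0 < eps ->
  measurable_fun (eball n eps) f -> (forall y, eball n eps y -> `|f y| <= C) ->
  (lebesgue_row n).-integrable (eball n eps) (EFin \o (fun y => f y * rho eps y)).
Proof.
move=> e0 mf fC; have mE := @measurable_eball R n eps.
apply: (@le_integrable _ _ _ _ _ mE _ (fun y => C%:E * (rho eps y)%:E)%E).
- by apply/measurable_EFinP; apply: measurable_funM => //; exact: measurable_rho.
- move=> y /fC fyC; rewrite /= lee_fin !normrM ler_wpM2r//.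
  by rewrite (le_trans fyC)// ler_norm.
- apply: integrableZl => //; apply/integrableP; split.
    by apply/measurable_EFinP; exact: measurable_rho.
  under eq_integral do rewrite /= ger0_norm ?rho_ge0//.
  by rewrite integral_rho// ltry.
Qed.

(** A Markov inequality: if [f >= a] on the whole cube, the average is at least [a] times the
    minimal density times the volume of the cube. That [kappa] depends on neither [f], [C] nor [a]
    is what permits iteration. *)
Lemma small_average_corner_box eps : 0 < eps -> exists2 kappa : R, 0 < kappa &
  forall f (C a : R), measurable_fun (eball n eps) f ->
    (forall y, eball n eps y -> 0 <= f y <= C) -> 0 < a ->
    \int[lebesgue_row n]_(y in eball n eps) (f y * rho eps y) < kappa * a ->
    exists2 y, corner_box (side n eps) y & f y < a.
Proof.
move=> e0; pose B := @corner_box R n (side n eps).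
pose c := fine (lebesgue_row n.+1 (eball n.+1 eps)).
have c0 : 0 < c by rewrite fine_gt0// eball_measure_gt0//= eball_measure_fin.
(* A lower bound for [rho] on the cube, from the norm bound there. *)
pose r := 2 * Num.sqrt (eps ^+ 2 - n%:R * (eps / n.+1%:R) ^+ 2) / c.
have r0 : 0 < r.
  by rewrite divr_gt0// mulr_gt0// sqrtr_gt0 subr_gt0 corner_box_bound.
have rB y : B y -> r <= rho eps y.
  move=> By; rewrite /r /rho ler_pM2r ?invr_gt0// ler_pM2l//.
  by rewrite ler_wsqrtr// lerD2l lerN2 corner_box_enorm.
have d0 := @side_gt0 R n _ e0.
have BE : B `<=` eball n eps by exact: corner_box_sub_eball.
have mE := @measurable_eball R n eps.
have mB : measurable B by exact: measurable_corner_box.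
exists (r * side n eps ^+ n); first by rewrite mulr_gt0// exprn_gt0.
move=> f C a mf fC a0 fint; apply/not_exists2P => fB.
have aB y : B y -> a <= f y by move=> By; have [//|/negP] := fB y; rewrite -leNgt.
have ifr : (lebesgue_row n).-integrable (eball n eps) (EFin \o (fun y => f y * rho eps y)).
  apply: (@integrable_mul_rho _ _ C) => // y /fC /andP[? ?].
  by rewrite ger0_norm.
have := fint; apply/negP; rewrite -leNgt -lee_fin fineK; last first.
  exact: integrable_fin_num.
apply: (@le_trans _ _ (\int[lebesgue_row n]_(y in B) (f y * rho eps y)%:E)%E); last first.
  apply: ge0_subset_integral => //.
    by case/integrableP : ifr.
  by move=> y /fC /andP[? ?]; rewrite lee_fin mulr_ge0// rho_ge0.
apply: (@le_trans _ _ (\int[lebesgue_row n]_(y in B) (cst (r * a)%:E y))%E).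
  rewrite integral_cst// [X in (_ * X)%E](corner_box_measure n d0) -EFinM lee_fin; lra.
apply: ge0_le_integral => //.
- by move=> y _; rewrite lee_fin mulr_ge0// ltW.
- by case/integrableP : ifr => mfr _; exact: measurable_funS mfr.
- by move=> y By; rewrite /= lee_fin [r * a]mulrC ler_pM ?(ltW a0) ?(ltW r0)// ?aB ?rB.
Qed.

End averaging.

(** * Monotonicity of the operators and the averaged deficit inequality *)

Section comparison.
Context {R : realType} {n : nat}.
Implicit Types (Omega : set 'rV[R]_n) (x : 'rV[R]_n) (u v : 'rV[R]_n -> R).
Implicit Types eps M C : R.

Lemma half_chord_le eps (t : R) : 0 < eps -> Num.sqrt (eps ^+ 2 - t ^+ 2) <= eps.
Proof.
move=> e0; rewrite -[leRHS]gtr0_norm// -sqrtr_sqr ler_wsqrtr//.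
by rewrite gerBl sqr_ge0.
Qed.

Lemma reach_refl Omega eps x : 0 < eps -> Omega x -> reach Omega eps x x.
Proof. by move=> e0 Ox; split; [left|rewrite subrr enorm0 ltW]. Qed.

(** The upper bound on [v] ensures that its [sup] is a true supremum and not the default 0. *)
Lemma le_Splus Omega eps u v x M C : 0 < eps -> Omega x ->
  (forall z, extended_domain Omega eps z -> v z <= C) ->
  (forall z, extended_domain Omega eps z -> u z <= v z + M) ->
  Splus Omega eps u x <= Splus Omega eps v x + M.
Proof.
move=> e0 Ox vC uv; apply: ge_sup.
  by exists (u x + Num.sqrt (eps ^+ 2 - enorm (x - x) ^+ 2)), x => //; exact: reach_refl.
move=> _ [z rz <-]; rewrite -lerBlDr; set s := Num.sqrt _.
apply: (@le_trans _ _ (v z + s)); first by have := uv z rz.1; lra.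
apply: ub_le_sup; last by exists z.
exists (C + eps) => _ [y [ey _] <-]; rewrite lerD ?vC//; exact: half_chord_le.
Qed.

(** Dually, the infimum that must be genuine is the one for [u], hence the lower bound on [u]. *)
Lemma le_Sminus Omega eps u v x M C : 0 < eps -> Omega x ->
  (forall z, extended_domain Omega eps z -> - C <= u z) ->
  (forall z, extended_domain Omega eps z -> u z <= v z + M) ->
  Sminus Omega eps u x <= Sminus Omega eps v x + M.
Proof.
move=> e0 Ox uC uv; rewrite -lerBlDr; apply: lb_le_inf.
  by exists (v x - Num.sqrt (eps ^+ 2 - enorm (x - x) ^+ 2)), x => //; exact: reach_refl.
move=> _ [z rz <-]; rewrite lerBlDr; set s := Num.sqrt _.
apply: (@le_trans _ _ (u z - s)); last by have := uv z rz.1; lra.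
apply: ge_inf; last by exists z.
exists (- C - eps) => _ [y [ey _] <-]; rewrite lerB ?uC//; exact: half_chord_le.
Qed.

Lemma T_op_interior Omega eps p F u x : Omega x ->
  T_op Omega eps p F u x =
  alpha_tilde n p / 2 * (Splus Omega eps u x + Sminus Omega eps u x) +
  beta_tilde n p *
    \int[lebesgue_row n]_(y in eball n eps) (u (x + y) * rho eps y).
Proof. by move=> Ox; rewrite /T_op ifF//; apply/negbTE/negP; rewrite inE => -[]. Qed.

Lemma bounded_borelP (A : set 'rV[R]_n) u : bounded_borel A u ->
  exists2 C, 0 <= C & forall x, A x -> `|u x| <= C.
Proof.
move=> [[C [_ uC]] _]; exists (`|C| + 1); first by rewrite addr_ge0.
by apply: uC; rewrite (le_lt_trans (ler_norm C))// ltrDl.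
Qed.

(** As [u] is measurable only on the extended domain, that set must be Borel and contain the
    translated ball. *)
Lemma measurable_translate Omega eps u x : 0 < eps -> Omega x ->
  measurable_fun (extended_domain Omega eps) u ->
  measurable_fun (eball n eps) (fun y => u (x + y)).
Proof.
move=> e0 Ox mu; apply: (measurable_comp _ _ mu).
- by apply: measurable_extended_domain => //; exists x.
- by move=> _ [y ye <-]; apply: extended_domain_near => //; exact: ltW.
- by apply: measurable_funTS; exact: measurable_translation.
Qed.

(** Subtracting the two equations and bounding both differences of [Splus] and [Sminus] by [M] gives
    [w x <= alpha * M + beta * avg w] for [w = u - v]; now use [alpha + beta = 1]. *)
Lemma deficit_average Omega eps p u v g h x M :
  0 < eps -> 2 <= p -> Omega x ->
  bounded_borel (extended_domain Omega eps) u ->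
  bounded_borel (extended_domain Omega eps) v ->
  T_op Omega eps p g u x = u x -> T_op Omega eps p h v x = v x ->
  (forall z, extended_domain Omega eps z -> u z - v z <= M) ->
  beta_tilde n p * \int[lebesgue_row n]_(y in eball n eps)
    ((M - (u (x + y) - v (x + y))) * rho eps y) <= M - (u x - v x).
Proof.
move=> e0 p2 Ox bu bv Tu Tv uvM.
have [Cu Cu0 uC] := bounded_borelP bu; have [Cv Cv0 vC] := bounded_borelP bv.
have uv z : extended_domain Omega eps z -> u z <= v z + M.
  by move=> /uvM; lra.
have Sp : Splus Omega eps u x <= Splus Omega eps v x + M.
  by apply: (@le_Splus _ _ _ _ _ _ Cv) => // z /vC; exact/le_trans/ler_norm.
have Sm : Sminus Omega eps u x <= Sminus Omega eps v x + M.
  by apply: (@le_Sminus _ _ _ _ _ _ Cu) => // z /uC; rewrite ler_norml => /andP[].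
have mE := @measurable_eball R n eps.
have E y : eball n eps y -> extended_domain Omega eps (x + y).
  by move=> ye; apply: extended_domain_near => //; exact: ltW.
have iu := integrable_mul_rho e0 (measurable_translate e0 Ox bu.2)
  (fun y Ey => uC _ (E y Ey)).
have iv := integrable_mul_rho e0 (measurable_translate e0 Ox bv.2)
  (fun y Ey => vC _ (E y Ey)).
have iM : (lebesgue_row n).-integrable (eball n eps) (EFin \o (fun y => M * rho eps y)).
  by apply: (@integrable_mul_rho _ _ _ (cst M) `|M|).
have i1 : (lebesgue_row n).-integrable (eball n eps) (EFin \o @rho R n eps).
  rewrite (_ : _ \o _ = EFin \o (fun y => cst 1 y * rho eps y)).
    exact: (@integrable_mul_rho _ _ _ (cst 1) `|1|).
  by apply/funext => y /=; rewrite mul1r.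
have -> : \int[lebesgue_row n]_(y in eball n eps)
    ((M - (u (x + y) - v (x + y))) * rho eps y) =
   M - (\int[lebesgue_row n]_(y in eball n eps) (u (x + y) * rho eps y) -
     \int[lebesgue_row n]_(y in eball n eps) (v (x + y) * rho eps y)).
  (* Mass one of [rho] turns the constant into an integral. *)
  have {2}-> : M = \int[lebesgue_row n]_(y in eball n eps) (M * rho eps y).
    by rewrite RintegralZl// /Rintegral integral_rho// mulr1.
  rewrite -RintegralB// -RintegralB//.
    by apply: eq_Rintegral => y _; rewrite !mulrBl.
  exact: (integrableB mE iu iv).
move: Tu Tv; rewrite !T_op_interior//.
set Iu := Rintegral _ _ _; set Iv := Rintegral _ _ _.
have n0 : 0 <= n%:R :> R by [].
(* Here [2 <= p] enters: the weight of the monotone terms must be nonnegative. *)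
have a0 : 0 <= alpha_tilde n p / 2 by rewrite /alpha_tilde !divr_ge0//; lra.
have ab : alpha_tilde n p + beta_tilde n p = 1.
  by rewrite /alpha_tilde /beta_tilde; field; rewrite lt0r_neq0//; lra.
have := ler_wpM2l a0 (lerD Sp Sm); have := congr1 ( *%R M) ab.
move: (alpha_tilde n p) (beta_tilde n p) => a b; lra.
Qed.

End comparison.

(** The bound is an arbitrary [m] instead of a supremum over the strip, so that [m = 0] also yields
    uniqueness. *)
Lemma comparison (R : realType) (n : nat) (Omega : set 'rV[R]_n) (eps p m : R)
    (u v g h : 'rV[R]_n -> R) :
  (0 < n)%N -> bounded_set Omega -> 0 < eps -> 2 <= p ->
  bounded_borel (extended_domain Omega eps) u ->
  bounded_borel (extended_domain Omega eps) v ->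
  (forall x, Omega x -> T_op Omega eps p g u x = u x) ->
  (forall x, Omega x -> T_op Omega eps p h v x = v x) ->
  (forall x, outer_strip Omega eps x -> u x - v x <= m) ->
  forall x, Omega x -> u x - v x <= m.
Proof.
move=> n0 Obnd e0 p2 bu bv Tu Tv strip_le x0 Ox0; rewrite leNgt; apply/negP => mx0.
have [Cu Cu0 uC] := bounded_borelP bu; have [Cv Cv0 vC] := bounded_borelP bv.
pose W := [set u x - v x | x in Omega].
have W_ub : has_ubound W.
  exists (Cu + Cv) => _ [x Ox <-].
  have := uC x (or_introl Ox); have := vC x (or_introl Ox).
  by rewrite !ler_norml => /andP[? ?] /andP[? ?]; lra.
have supW : has_sup W by split => //; exists (u x0 - v x0), x0.
set M := sup W.
have WM x : Omega x -> u x - v x <= M by move=> Ox; apply: ub_le_sup => //; exists x.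
have mM : m < M by apply: lt_le_trans mx0 (WM _ Ox0).
have extM x : extended_domain Omega eps x -> u x - v x <= M.
  by case=> [/WM//|/strip_le/le_trans]; apply; exact: ltW.
have [kappa k0 step] := @small_average_corner_box R n _ e0.
pose i0 := Ordinal n0.
have [C [_ /(_ (`|C| + 1))]] := Obnd.
set K := `|C| + 1 => /(_ _) OK.
have {}OK x : Omega x -> `|x ord0 i0| <= K.
  move=> Ox; apply: le_trans (OK _ x Ox); last first.
    by rewrite (le_lt_trans (ler_norm C))// ltrDl.
  rewrite [leRHS]/Num.Def.normr/= mx_normrE.
  exact: (le_bigmax _ (fun ij => `|x ij.1 ij.2|) (ord0, i0)).
have nR : 0 <= n%:R :> R by [].
have b0 : 0 < beta_tilde n p by rewrite /beta_tilde divr_gt0//; lra.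
pose d := side n eps.
have d0 : 0 < d by exact: side_gt0.
(* Each step starts from a point whose deficit meets a different, already prescribed tolerance, so
   the induction must quantify over [eta]. *)
have climb k : forall eta, 0 < eta -> exists x,
    [/\ Omega x, M - eta < u x - v x & - K + k%:R * d <= x ord0 i0].
  elim: k => [|k IH] eta eta0.
    have [_ [x Ox <-] xM] := sup_adherent eta0 supW.
    exists x; split => //; rewrite mul0r addr0.
    by have := OK x Ox; rewrite ler_norml => /andP[].
  (* A deficit below [eta] is the new requirement; one below [M - m] keeps the new point off the
     strip. *)
  pose a := Num.min eta (M - m).
  have a0 : 0 < a by rewrite lt_min eta0 subr_gt0.
  have [|x [Ox xM xk]] := IH (beta_tilde n p * (kappa * a)); first by rewrite mulr_gt0// mulr_gt0.
  have avg := deficit_average e0 p2 Ox bu bv (Tu _ Ox) (Tv _ Ox) extM.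
  have E y : eball n eps y -> extended_domain Omega eps (x + y).
    by move=> ye; apply: extended_domain_near => //; exact: ltW.
  have [||||y yB ya] := step (fun y => M - (u (x + y) - v (x + y))) (M + Cu + Cv) a.
  - apply: measurable_funB => //; apply: measurable_funB.
      exact: measurable_translate bu.2.
    exact: measurable_translate bv.2.
  - move=> y /E Ey; rewrite subr_ge0 extM//=.
    have := uC _ Ey; have := vC _ Ey.
    by rewrite !ler_norml => /andP[? ?] /andP[? ?]; lra.
  - exact: a0.
  - by rewrite -(ltr_pM2l b0); apply: le_lt_trans avg _; lra.
  have [aeta aM] : a <= eta /\ a <= M - m by rewrite !ge_min !lexx orbT.
  exists (x + y); split.
  - case: (E _ (corner_box_sub_eball e0 yB)) => // /strip_le; lra.
  - lra.
  - have := yB i0; rewrite /= in_itv/= => /andP[yd _]; rewrite mxE.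
    have -> : k.+1%:R * d = k%:R * d + d by rewrite -natr1 mulrDl mul1r.
    by move: yd xk; rewrite -/d; lra.
(* This many steps of length [d] exceed [2 * K], the width of the interval holding all first
   coordinates; the tolerance 1 is arbitrary. *)
have [x [Ox _ xK]] := climb (Num.truncn (2 * K / d)).+1 1 ltr01.
have := truncnS_gt (2 * K / d); rewrite ltr_pdivrMr// => Kd.
have := OK x Ox; rewrite ler_norml => /andP[_]; lra.
Qed.

Theorem theorem4p3 (R : realType) (n : nat) (Omega : set 'rV[R]_n) (eps p : R)
    (n_ge1 : (1 <= n)%N) (Omega_domain : domain Omega)
    (Omega_bounded : bounded_set Omega) (eps_gt0 : 0 < eps) (p_ge2 : 2 <= p) :
  (forall u v g h : 'rV[R]_n -> R,
     bounded_borel (extended_domain Omega eps) u ->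
     bounded_borel (extended_domain Omega eps) v ->
     (forall x, outer_strip Omega eps x -> g x = u x) ->
     (forall x, outer_strip Omega eps x -> h x = v x) ->
     (forall x, extended_domain Omega eps x -> T_op Omega eps p g u x = u x) ->
     (forall x, extended_domain Omega eps x -> T_op Omega eps p h v x = v x) ->
     sup [set u x - v x | x in Omega] <=
     sup [set g x - h x | x in outer_strip Omega eps]) /\
  (forall F : 'rV[R]_n -> R,
     bounded_borel (outer_strip Omega eps) F ->
     forall v w : 'rV[R]_n -> R,
     bounded_borel (extended_domain Omega eps) v ->
     bounded_borel (extended_domain Omega eps) w ->
     (forall x, outer_strip Omega eps x -> v x = F x) ->
     (forall x, outer_strip Omega eps x -> w x = F x) ->
     (forall x, extended_domain Omega eps x -> T_op Omega eps p F v x = v x) ->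
     (forall x, extended_domain Omega eps x -> T_op Omega eps p F w x = w x) ->
     forall x, extended_domain Omega eps x -> v x = w x).
Proof.
have [[x0 Ox0] _ _] := Omega_domain.
split=> [u v g h bu bv gu hv Tu Tv|F _ v w bv bw vF wF Tv Tw x].
  have cmp m := @comparison _ _ Omega eps p m u v g h n_ge1 Omega_bounded eps_gt0
    p_ge2 bu bv (fun x Ox => Tu x (or_introl Ox)) (fun x Ox => Tv x (or_introl Ox)).
  (* [sup set0 = 0], so the boundary strip has to be shown nonempty: otherwise
     [comparison] would hold for every [m]. *)
  have [x1 sx1] : outer_strip Omega eps !=set0.
    apply/set0P/negP => /eqP s0.
    have := cmp (u x0 - v x0 - 1) _ x0 Ox0; rewrite s0 => /(_ (fun _ => False_ind _)).
    lra.
  apply: ge_sup; first by exists (u x0 - v x0), x0.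
  move=> _ [x Ox <-]; apply: cmp Ox => {}x sx; apply: ub_le_sup; last first.
    by exists x => //; rewrite gu// hv.
  have [Cu _ uC] := bounded_borelP bu; have [Cv _ vC] := bounded_borelP bv.
  exists (Cu + Cv) => _ [y sy <-]; rewrite gu// hv//.
  have := uC y (or_intror sy); have := vC y (or_intror sy).
  by rewrite !ler_norml => /andP[? ?] /andP[? ?]; lra.
(* With equal boundary values the comparison holds with [m = 0]; applying it in both orders gives
   equality. *)
have cmp a b : bounded_borel (extended_domain Omega eps) a ->
    bounded_borel (extended_domain Omega eps) b ->
    (forall x, outer_strip Omega eps x -> a x = F x) ->
    (forall x, outer_strip Omega eps x -> b x = F x) ->
    (forall x, extended_domain Omega eps x -> T_op Omega eps p F a x = a x) ->
    (forall x, extended_domain Omega eps x -> T_op Omega eps p F b x = b x) ->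
    forall y, Omega y -> a y <= b y.
  move=> ba bb aF bF Ta Tb y Oy; rewrite -subr_le0.
  apply: (@comparison _ _ Omega eps p 0 a b F F) => // z zO.
  - by apply: Ta; left.
  - by apply: Tb; left.
  - by rewrite aF// bF// subrr.
case=> [Ox|sx]; last by rewrite vF// wF.
by apply/eqP; rewrite eq_le !cmp.
Qed.
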